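(* Let $L=\mathfrak{sl}_2(\mathbb{F}_q)$ with $q$ odd, and let $\mathcal{L}$ be the set of lines (one-dimensional subalgebras), $\mathcal{B}$ the set of Borel subalgebras, and $\mathcal{N},\mathcal{L}_s,\mathcal{L}_{ns}\subseteq\mathcal{L}$ the sets of nilpotent, split semisimple and nonsplit semisimple lines of $L$. Then, in the comaximal graph $\Gamma(L)$: (1) For every $B\in\mathcal{B}$, $\deg(B)=q^2+q$. (2) For $A\in\mathcal{L}$, $\deg(A)=q^2+q$ if $A\in\mathcal{N}$, $\deg(A)=q^2-1$ if $A\in\mathcal{L}_s$, and $\deg(A)=(q+1)^2$ if $A\in\mathcal{L}_{ns}$. In particular, every Borel subalgebra of $L$ and every nilpotent line have the same degree $q^2+q$. (3) The degree sequence of $\Gamma(L)$ (as a multiset) consists of $q^2+q$ with multiplicity $2(q+1)$, $q^2-1$ with multiplicity $\frac{q(q+1)}{2}$, and $(q+1)^2$ with multiplicity $\frac{q(q-1)}{2}$. In particular, $\Gamma(L)$ is not regular for $q\geq3$. (4) $\Gamma(L)$ has order $(q+1)^2+1$ and size $\frac{q(q+1)^3}{2}$.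
   Context: The comaximal graph $\Gamma(L)$ of a finite-dimensional Lie algebra $L$ is the simple undirected graph whose vertices are the nonzero proper Lie subalgebras of $L$, two distinct vertices $A,B$ being adjacent if and only if $\langle A,B\rangle=L$, where $\langle A,B\rangle$ denotes the Lie subalgebra generated by $A\cup B$. The Borel subalgebras of $\mathfrak{sl}_2(\mathbb{F}_q)$ are its two-dimensional Lie subalgebras. A line of $\mathfrak{sl}_2(\mathbb{F}_q)$ spanned by a nonzero matrix $u$ is nilpotent if $u$ is a nilpotent matrix, split semisimple if $u$ is diagonalizable over $\mathbb{F}_q$, and nonsplit semisimple if the characteristic polynomial of $u$ has no root in $\mathbb{F}_q$; every line is of exactly one of these types. The order and size of a graph are its numbers of vertices and edges. *)

(* Defs.v *)
From HB Require Import structures.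
From mathcomp Require Import all_boot all_order all_algebra.
Set Implicit Arguments. Unset Strict Implicit. Unset Printing Implicit Defensive.
Import GRing.Theory VectorInternalTheory.
Local Open Scope ring_scope.

(* Over a finite field there are finitely many subspaces. *)
HB.instance Definition _ (F : finFieldType) (vT : vectType F) :=
  [Countable of {vspace vT} by <:].
HB.instance Definition _ (F : finFieldType) (vT : vectType F) :=
  [Finite of {vspace vT} by <:].

Record sgraph (T : finType) := SGraph {
  vertices : {set T};
  adj : rel T;
  adj_sym : symmetric adj;
  adj_irrefl : irreflexive adj;
  adj_vertices : forall x y, adj x y -> x \in vertices
}.

Section GraphInvariants.
Variables (T : finType) (G : sgraph T).

Definition degree (x : T) : nat := #|[set y | adj G x y]|.

Definition edges : {set {set T}} :=
  [set e | [exists x, exists y, adj G x y && (e == [set x; y])]].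

Definition graph_order : nat := #|vertices G|.

Definition graph_size : nat := #|edges|.

(* The multiset of vertex degrees: a sequence, to be compared with perm_eq. *)
Definition degree_seq : seq nat := [seq degree x | x <- enum (vertices G)].

Definition regular : Prop :=
  exists k, forall x, x \in vertices G -> degree x = k.

End GraphInvariants.

(* The ambient Lie algebra L is given as a subspace of gl_n(F), with the
   commutator bracket.  The definitions are meant for L itself closed under the
   bracket: it is then a member of the family intersected in lie_gen. *)
Section MatrixLieAlgebras.
Variables (F : finFieldType) (n : nat).
Implicit Types (x y : 'M[F]_n) (L A B U : {vspace 'M[F]_n}).

Definition lie_bracket x y : 'M[F]_n := x *m y - y *m x.

Definition lie_closed U : bool :=
  [forall x in U, forall y in U, lie_bracket x y \in U].

Definition lie_subalg L A : bool := (A <= L)%VS && lie_closed A.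

Definition lie_gen L A B : {vspace 'M[F]_n} :=
  (\bigcap_(U : {vspace 'M[F]_n} | [&& lie_subalg L U, A <= U & B <= U]) U)%VS.

Definition comax_vertices L : {set {vspace 'M[F]_n}} :=
  [set A | [&& lie_subalg L A, A != 0%VS & A != L]].

Definition comax_adj L : rel {vspace 'M[F]_n} := fun A B =>
  [&& A \in comax_vertices L, B \in comax_vertices L, A != B
    & lie_gen L A B == L].

Lemma comax_adj_sym L : symmetric (comax_adj L).
Proof.
move=> A B; rewrite /comax_adj /lie_gen andbCA eq_sym.
by under eq_bigl do rewrite (andbC (A <= _)%VS).
Qed.

Lemma comax_adj_irrefl L : irreflexive (comax_adj L).
Proof. by move=> A; rewrite /comax_adj eqxx !andbF. Qed.

Lemma comax_adj_vertices L A B : comax_adj L A B -> A \in comax_vertices L.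
Proof. by case/and4P. Qed.

Definition comaximal_graph L : sgraph {vspace 'M[F]_n} :=
  SGraph (@comax_adj_sym L) (@comax_adj_irrefl L) (@comax_adj_vertices L).

Definition sl : {vspace 'M[F]_n} := lker (linfun (mxtrace : 'M[F]_n -> F^o)).

Lemma mem_sl x : (x \in sl) = (\tr x == 0).
Proof. by rewrite memv_ker lfunE. Qed.

Lemma sl_lie_subalg : lie_subalg sl sl.
Proof.
rewrite /lie_subalg subvv /=.
apply/forall_inP=> x _; apply/forall_inP=> y _.
by rewrite mem_sl /lie_bracket linearB /= mxtrace_mulC subrr.
Qed.

End MatrixLieAlgebras.

Arguments sl F n : clear implicits.

Section Sl2.
Variable F : finFieldType.
Local Notation sl2 := (sl F 2).
Implicit Type A : {vspace 'M[F]_2}.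

Definition sl2_line A : Prop := lie_subalg sl2 A /\ \dim A = 1.

Definition sl2_borel A : Prop := lie_subalg sl2 A /\ \dim A = 2.

Definition nilpotent_line A : Prop :=
  sl2_line A /\
  exists u : 'M[F]_2, [/\ u != 0, A = <[u]>%VS & exists k, u ^+ k = 0].

Definition split_ss_line A : Prop :=
  sl2_line A /\
  exists u : 'M[F]_2, [/\ u != 0, A = <[u]>%VS & diagonalizable u].

Definition nonsplit_ss_line A : Prop :=
  sl2_line A /\
  exists u : 'M[F]_2,
    [/\ u != 0, A = <[u]>%VS & forall a : F, ~~ root (char_poly u) a].

End Sl2.

(* Main.v *)
Require Import Defs.
From mathcomp Require Import all_boot all_order all_algebra.
From mathcomp Require Import all_fingroup all_solvable all_field.
From mathcomp Require Import ring zify.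

(* The Borel subalgebras are the orthogonals, for the trace form, of the
   q + 1 nilpotent lines: a plane is the orthogonal of the bracket of a basis,
   so it is a subalgebra iff that bracket is isotropic.  Two distinct vertices
   are non-adjacent iff they lie in a common Borel subalgebra, which is then
   unique, and each Borel subalgebra contains q + 2 vertices (itself and its
   q + 1 lines).  Hence a vertex lying in k Borel subalgebras has degree
   (q + 1)(q + 1 - k).  For a line spanned by u, k is the number of roots on the
   projective line of a binary quadratic form of discriminant - 4 det u, so
   k = 1, 2, 0 in the nilpotent, split and nonsplit case; k = 1 for a Borel
   subalgebra.  The multiplicities follow by double counting the incidences. *)

Set Implicit Arguments. Unset Strict Implicit. Unset Printing Implicit Defensive.
Import GRing.Theory FinRing.Theory.

(** * Counting tools: edges, lines of a vector space, fibres of a small-valued function *)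

Lemma handshake (T : finType) (G : sgraph T) :
  \sum_(x in vertices G) degree G x = 2 * graph_size G.
Proof.
have degE x : degree G x = \sum_(e in edges G) (x \in e).
  (* The map y -> {x, y} is injective on neighbours because x is not its own neighbour; its image is
     the set of edges through x. *)
  rewrite /degree -(card_in_imset (f := fun y => [set x; y])) /=; last first.
    move=> y z; rewrite !inE => xy xz /setP/(_ y).
    rewrite !inE eqxx orbT => /esym/orP[]/eqP // yx.
    by rewrite yx adj_irrefl in xy.
  rewrite -sum1_card [RHS]big_mkcond.
  rewrite [LHS]big_mkcond; apply: eq_bigr => e _.
  suff -> : (e \in [set [set x; y] | y in [set y | adj G x y]])
      = (e \in edges G) && (x \in e) by case: (e \in edges G); case: (x \in e).
  apply/imsetP/andP => [[y]|[]].
    rewrite !inE => xy ->; split; last by rewrite !inE eqxx.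
    by apply/existsP; exists x; apply/existsP; exists y; rewrite xy eqxx.
  rewrite inE => /existsP[a /existsP[b /andP[ab /eqP->]]].
  rewrite !inE => /orP[]/eqP->; first by exists b; rewrite ?inE.
  by exists a; rewrite 1?setUC // inE adj_sym.
(* The degree vanishes off the vertex set, so the sum may run over the whole type. *)
rewrite big_mkcond (eq_bigr (degree G)) => [|x _]; last first.
  case: ifPn => // xV; apply/esym/eqP; rewrite cards_eq0.
  by apply/eqP/setP => y; rewrite !inE; apply/negP => /adj_vertices; apply/negP.
rewrite (eq_bigr _ (fun x _ => degE x)) exchange_big /=.
rewrite mulnC /graph_size -sum1_card big_distrl /=.
apply: eq_bigr => e; rewrite inE => /existsP[a /existsP[b /andP[ab /eqP->]]].
rewrite -big_mkcond sum1_card cards2.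
by case: eqP ab => // ->; rewrite adj_irrefl.
Qed.

(** The nonzero vectors of [U] are partitioned by the line they span, and each line contributes
    [#|F| - 1] of them. *)
Lemma card_lines (F : finFieldType) (vT : vectType F) (U : {vspace vT}) :
  #|[set A : {vspace vT} | (A <= U)%VS && (\dim A == 1)]| * (#|F| - 1)
    = #|F| ^ \dim U - 1.
Proof.
case: vT U => sT cT; set vT : vectType F := Vector.Pack cT => U.
pose T := finvect_type vT.
have card_nz (V : {vspace vT}) : #|[set v : T | (v \in V) && (v != 0%R)]|
    = #|F| ^ \dim V - 1.
  rewrite -(@card_vspace F T cT V) (cardD1 (0%R : T) (mem V)) mem0v add1n subn1.
  by apply: eq_card => v; rewrite !inE andbC.
rewrite -(card_nz U) -[RHS]sum1_card.
rewrite (partition_big (fun v : T => <[v : vT]>%VS)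
  (mem [set A : {vspace vT} | (A <= U)%VS && (\dim A == 1)])) /=; last first.
  by move=> v; rewrite (@in_set T) !inE dim_vline -memvE => /andP[-> ->].
rewrite -[in LHS]sum1_card big_distrl /=; apply: eq_bigr => A.
rewrite inE => /andP[sAU /eqP dA].
have -> : #|F| - 1 = #|F| ^ \dim A - 1 by rewrite dA expn1.
rewrite mul1n sum1_card -card_nz.
apply: eq_card => v; rewrite (@in_set T) [RHS]unfold_in /= (@in_set T).
have [->|v0] /= := eqVneq v 0%R; first by rewrite !andbF.
rewrite !andbT; apply/idP/andP => [vA|[_ /eqP<-]]; last exact: memv_line.
have vA' : (<[v : vT]> <= A)%VS by rewrite -memvE.
split; first exact: (subvP sAU).
by rewrite eqEdim vA' dA dim_vline v0.
Qed.

(** If 2 = 0, the additive order of 1 divides 2 and, by Lagrange, the odd number [#|F|]; it would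
    then be 1, forcing 1 = 0. *)
Lemma odd_card_nat2_neq0 (F : finFieldType) : odd #|F| -> (2%:R : F)%R != 0%R.
Proof.
move=> oddF; apply/eqP => two0.
have d2 : #[1%R : F]%g %| 2 by rewrite order_dvdn zmodXgE two0.
have dF : #[1%R : F]%g %| #|F| by rewrite -cardsT order_dvdG ?inE.
have : #[1%R : F]%g %| gcdn 2 #|F| by rewrite dvdn_gcd d2.
have /eqP-> : coprime 2 #|F| by rewrite coprime2n.
by rewrite dvdn1 order_eq1 => /eqP/eqP; rewrite (oner_eq0 F).
Qed.

(** For a vertex, [k] will be the number of Borel subalgebras above it and [g] the degree this
    number determines; the blocks 1, 2, 0 follow the order of the degree sequence to be proved. *)
Lemma perm_map_fibers3 (T : eqType) (k : T -> nat) (g : nat -> nat) (s : seq T) :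
  {in s, forall x, k x < 3} ->
  perm_eq [seq g (k x) | x <- s]
    (nseq (count (fun x => k x == 1) s) (g 1)
       ++ nseq (count (fun x => k x == 2) s) (g 2)
       ++ nseq (count (fun x => k x == 0) s) (g 0)).
Proof.
move=> k3; apply/seq.permP => P; rewrite !count_cat !count_nseq.
elim: s k3 => [|x s IHs] k3 /=; first by rewrite !muln0.
rewrite IHs => [|y ys]; last by apply: k3; rewrite inE ys orbT.
have := k3 x (mem_head _ _).
by case: (k x) => [|[|[|]]] //= _; ring.
Qed.

(** Two linear equations for the three fibre sizes: once the fibre over 1 is known, they determine
    the other two. *)
Lemma sum_count_fibers3 (T : eqType) (k : T -> nat) (s : seq T) :
  {in s, forall x, k x < 3} ->
  (\sum_(x <- s) k x = count (fun x => k x == 1) s + 2 * count (fun x => k x == 2) s) /\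
  (size s = count (fun x => k x == 1) s + count (fun x => k x == 2) s +
    count (fun x => k x == 0) s).
Proof.
elim: s => [|x s IHs] k3 /=; first by rewrite big_nil.
rewrite big_cons; have [|-> ->] := IHs.
  by move=> y ys; apply: k3; rewrite inE ys orbT.
have := k3 x (mem_head _ _).
by case: (k x) => [|[|[|]]] //= _; split; ring.
Qed.

(** * Coordinates on the Lie algebra and classification of its Borel subalgebras *)

Local Open Scope ring_scope.

Definition sl2_mx (R : pzRingType) (a b c : R) : 'M[R]_2 :=
  \matrix_(i, j) if i == 0 then (if j == 0 then a else b)
                 else (if j == 0 then c else - a).

Section Sl2Structure.
Variable F : finFieldType.
Hypothesis two_neq0 : (2%:R : F) != 0.
Local Notation sl2 := (sl F 2).
Implicit Types (a b c t : F) (u x y : 'M[F]_2) (A : {vspace 'M[F]_2}).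
Implicit Types (p : option F).

Lemma eq_sl2_mx a b c a' b' c' :
  (sl2_mx a b c == sl2_mx a' b' c') = [&& a == a', b == b' & c == c'].
Proof.
apply/eqP/and3P => [/matrixP E|[/eqP-> /eqP-> /eqP->] //].
by have := (E 0 0, E 0 1, E 1 0); rewrite !mxE /= => -[[-> ->] ->].
Qed.

Lemma sl2_mx_eq0 a b c : (sl2_mx a b c == 0) = [&& a == 0, b == 0 & c == 0].
Proof.
suff <- : sl2_mx 0 0 0 = 0 :> 'M[F]_2 by rewrite eq_sl2_mx.
by apply/matrixP => i j; rewrite !mxE oppr0; do 2 case: ifP.
Qed.

Lemma scale_sl2_mx t a b c : t *: sl2_mx a b c = sl2_mx (t * a) (t * b) (t * c).
Proof. by apply/matrixP => i j; rewrite !mxE; do 2 case: ifP => _ //; rewrite mulrN. Qed.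

Lemma mem_sl2_mx a b c : sl2_mx a b c \in sl2.
Proof. by rewrite mem_sl /mxtrace !big_ord_recl big_ord0 !mxE /= addr0 subrr. Qed.

Lemma sl2_mxP x : x \in sl2 -> {abc | x = sl2_mx abc.1.1 abc.1.2 abc.2}.
Proof.
rewrite mem_sl /mxtrace !big_ord_recl big_ord0 addr0 addrC addr_eq0 => /eqP x11.
exists (x 0 0, x 0 1, x 1 0); apply/matrixP => i j; rewrite !mxE /=.
case: i => [[|[|//]] i2]; case: j => [[|[|//]] j2] /=;
  rewrite -?x11; congr (x _ _); exact: val_inj.
Qed.

Lemma mul_sl2_mx a b c a' b' c' : sl2_mx a b c *m sl2_mx a' b' c' =
  \matrix_(i, j) if i == 0
    then (if j == 0 then a * a' + b * c' else a * b' - b * a')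
    else (if j == 0 then c * a' - a * c' else c * b' + a * a').
Proof.
apply/matrixP => i j; rewrite !mxE !big_ord_recl big_ord0 !mxE /=.
by do 2 case: ifP => _; ring.
Qed.

Lemma bracket_sl2_mx a b c a' b' c' :
  lie_bracket (sl2_mx a b c) (sl2_mx a' b' c') =
  sl2_mx (b * c' - c * b') (2%:R * (a * b' - b * a')) (2%:R * (c * a' - a * c')).
Proof.
rewrite /lie_bracket !mul_sl2_mx; apply/matrixP => i j; rewrite !mxE.
by do 2 case: ifP => _; ring.
Qed.

Lemma tr_mul_sl2_mx a b c a' b' c' :
  \tr (sl2_mx a b c *m sl2_mx a' b' c') = 2%:R * a * a' + b * c' + c * b'.
Proof. by rewrite mul_sl2_mx /mxtrace !big_ord_recl big_ord0 !mxE /=; ring. Qed.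

(* [None] is the point at infinity: [option F] is the projective line, which
   parametrizes both the nilpotent lines and their orthogonals for the trace
   form, the Borel subalgebras. *)
Definition nilp_mx p : 'M[F]_2 :=
  if p is Some t then sl2_mx t (- t ^+ 2) 1 else sl2_mx 0 1 0.

Definition borel p : {vspace 'M[F]_2} :=
  (sl2 :&: lker (linfun (mxtrace \o mulmxr (nilp_mx p) : 'M[F]_2 -> F^o)))%VS.

Lemma mem_borel p x : (x \in borel p) = (x \in sl2) && (\tr (x *m nilp_mx p) == 0).
Proof. by rewrite memv_cap memv_ker lfunE. Qed.

(** The binary quadratic form - c t^2 + 2 a t + b, of discriminant 4 (a^2 + b c), evaluated at a
    point of the projective line; at infinity only the leading coefficient remains, up to sign. *)
Definition borel_eq p a b c :=
  if p is Some t then 2%:R * a * t + b - c * t ^+ 2 else c.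

Lemma mem_borel_mx p a b c : (sl2_mx a b c \in borel p) = (borel_eq p a b c == 0).
Proof.
rewrite mem_borel mem_sl2_mx /nilp_mx.
by case: p => [t|]; rewrite tr_mul_sl2_mx /=; congr (_ == _); ring.
Qed.

Lemma nilp_sl2 p : nilp_mx p \in sl2.
Proof. by case: p => [t|]; apply: mem_sl2_mx. Qed.

(** At finite points t and s the trace pairing of the two nilpotent matrices is - (t - s)^2. *)
Lemma nilp_borel p p' : (nilp_mx p \in borel p') = (p == p').
Proof.
case: p p' => [t|] [s|] /=; rewrite mem_borel_mx /= ?eqxx ?oner_eq0 //.
  rewrite (inj_eq Some_inj) -(subr_eq0 t s) -(sqrf_eq0 (t - s)) -[RHS]oppr_eq0.
  by congr (_ == _); ring.
by rewrite mulr0 mul0r add0r mul0r subr0 oner_eq0.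
Qed.

Lemma nilp_neq0 p : nilp_mx p != 0.
Proof. by case: p => [t|] /=; rewrite sl2_mx_eq0 oner_eq0 ?andbF. Qed.

Lemma borel_sub_sl2 p : (borel p <= sl2)%VS.
Proof. exact: capvSl. Qed.

Lemma dim_cap_lker (vT : vectType F) (U : {vspace vT}) (f : 'Hom(vT, F^o)) (x : vT) :
  x \in U -> f x != 0 -> (\dim (U :&: lker f) + 1)%N = \dim U.
Proof.
move=> xU fx; rewrite -(limg_ker_dim f U); congr addn.
apply/esym/eqP; rewrite eqn_leq -{1}[1%N](dimvf F^o) dimvS ?subvf //=.
have : (<[f x]> <= f @: U)%VS by rewrite -memvE memv_img.
by move/dimvS; rewrite dim_vline fx.
Qed.

Lemma dim_sl2 : \dim sl2 = 3.
Proof.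
have := dim_cap_lker (U := fullv) (f := linfun (mxtrace : 'M[F]_2 -> F^o)) (x := 1%:M).
rewrite capfv dimvf dim_matrix lfunE /= => /(_ (memvf _)) E.
by apply: (@addIn 1); rewrite E // mxtrace1.
Qed.

Lemma dim_borel p : \dim (borel p) = 2.
Proof.
(* A matrix whose trace pairing with [nilp_mx p] is 1, so the orthogonal is a proper subspace. *)
pose v := if p is Some _ then sl2_mx 0 1 0 else sl2_mx 0 0 1 : 'M[F]_2.
apply: (@addIn 1); rewrite (dim_cap_lker (x := v)) ?dim_sl2 //.
  by rewrite {}/v; case: p => [t|]; rewrite mem_sl2_mx.
rewrite lfunE /= {}/v /nilp_mx; case: p => [t|]; rewrite tr_mul_sl2_mx;
  rewrite [X in X != 0](_ : _ = 1) ?oner_eq0 //; ring.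
Qed.

Lemma borel_inj : injective borel.
Proof. by move=> p p' E; apply/eqP; rewrite -nilp_borel -E nilp_borel. Qed.

Lemma borel_subset_eq p p' : (borel p <= borel p')%VS = (p == p').
Proof.
apply/idP/eqP => [sub|->]; last exact: subvv.
by apply/eqP; rewrite -nilp_borel (subvP sub) // nilp_borel.
Qed.

Lemma borel_lie_subalg p : lie_subalg sl2 (borel p).
Proof.
rewrite /lie_subalg borel_sub_sl2; apply/forall_inP => x xB; apply/forall_inP => y.
move: xB; rewrite !mem_borel => /andP[/sl2_mxP[[[a b] c] ->]] /=.
move=> + /andP[/sl2_mxP[[[a' b'] c'] ->]] /=.
move=> /(conj (mem_sl2_mx a b c))/andP; rewrite -mem_borel mem_borel_mx => /eqP Hx.
move=> /(conj (mem_sl2_mx a' b' c'))/andP; rewrite -mem_borel mem_borel_mx => /eqP Hy.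
rewrite -mem_borel bracket_sl2_mx mem_borel_mx; apply/eqP.
case: p Hx Hy => [t|] /= Hx Hy; last by rewrite Hx Hy; ring.
(* The form has coefficient 1 at b, so membership expresses b, and likewise b', through the other
   coordinates; the claim for the bracket becomes a polynomial identity. *)
have -> : b = c * t ^+ 2 - 2%:R * a * t.
  by apply/eqP; rewrite -subr_eq0 -Hx; apply/eqP; ring.
have -> : b' = c' * t ^+ 2 - 2%:R * a' * t.
  by apply/eqP; rewrite -subr_eq0 -Hy; apply/eqP; ring.
ring.
Qed.

(** The conic a^2 + b c = 0 is parametrized by t -> (t : - t^2 : 1), with inverse t = a / c; its
    only point with c = 0 is (0 : 1 : 0). *)
Lemma isotropic_nilp a b c : sl2_mx a b c != 0 -> a ^+ 2 + b * c = 0 ->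
  exists p k, k != 0 /\ sl2_mx a b c = k *: nilp_mx p.
Proof.
rewrite sl2_mx_eq0; have [->|c0] := eqVneq c 0.
  rewrite mulr0 addr0 => + /eqP; rewrite sqrf_eq0 => + /eqP a0.
  rewrite a0 eqxx andbT => /= b0; exists None, b.
  by rewrite /= scale_sl2_mx !mulr0 mulr1.
move=> _ /eqP; rewrite addrC addr_eq0 => /eqP E.
exists (Some (a / c)), c; split => //=; rewrite scale_sl2_mx; apply/eqP.
rewrite eq_sl2_mx mulr1 eqxx andbT; apply/andP; split; apply/eqP.
  by field.
by have -> : b = - a ^+ 2 / c; [rewrite -E; field | field].
Qed.

(** Up to sign and the invertible factor 2, the coordinates of the bracket are the 2 x 2 minors of
    the coordinate vectors of [x] and [y]; any nonzero coordinate of [x] supplies the ratio. *)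
Lemma sl2_bracket_eq0 x y :
  x \in sl2 -> y \in sl2 -> x != 0 -> lie_bracket x y = 0 -> y \in <[x]>%VS.
Proof.
move=> /sl2_mxP[[[a b] c] ->] /sl2_mxP[[[a' b'] c'] ->] /= x0.
move/eqP; rewrite bracket_sl2_mx sl2_mx_eq0 !mulf_eq0 (negPf two_neq0) /=.
rewrite !subr_eq0 => /and3P[/eqP bc /eqP ab /eqP ca].
apply/vlineP; move: x0; rewrite sl2_mx_eq0.
have [a0|a0 _] := eqVneq a 0; last first.
  exists (a' / a); rewrite scale_sl2_mx; apply/eqP; rewrite eq_sl2_mx.
  apply/and3P; split; apply/eqP; first by field.
    by rewrite mulrAC (mulrC a') -ab mulrAC mulfV // mul1r.
  by rewrite mulrAC (mulrC a') ca mulrAC mulfV // mul1r.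
have [b0|b0 _] := eqVneq b 0; last first.
  exists (b' / b); rewrite scale_sl2_mx; apply/eqP; rewrite eq_sl2_mx.
  apply/and3P; split; apply/eqP; last 2 first.
  - by field.
  - by rewrite mulrAC (mulrC b') -bc mulrAC mulfV // mul1r.
  rewrite a0 mulr0; apply/eqP; move: ab; rewrite a0 mul0r => /esym/eqP.
  by rewrite mulf_eq0 (negPf b0).
move=> /= c0; exists (c' / c); rewrite scale_sl2_mx; apply/eqP; rewrite eq_sl2_mx.
move: ab bc ca; rewrite a0 b0 !mul0r => _ /esym/eqP + /eqP.
by rewrite !mulf_eq0 (negPf c0) /= mulfVK // => /eqP-> /eqP->; rewrite !mulr0 !eqxx.
Qed.

Lemma tr_bracket_l x y : \tr (lie_bracket x y *m x) = 0.
Proof.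
by rewrite /lie_bracket mulmxBl linearB /= -mulmxA mxtrace_mulC subrr.
Qed.

Lemma tr_bracket_r x y : \tr (lie_bracket x y *m y) = 0.
Proof.
by rewrite /lie_bracket mulmxBl linearB /= [X in X - _]mxtrace_mulC mulmxA subrr.
Qed.

Lemma plane_subalg_borel A : sl2_borel A -> exists p, A = borel p.
Proof.
case=> /andP[sA /forall_inP clA] dA.
have A0 : A != 0%VS by rewrite -dimv_eq0 dA.
pose x := vpick A.
have x0 : x != 0 by rewrite vpick0.
have xA : x \in A by exact: memv_pick.
have /subvPn[y yA yx] : ~~ (A <= <[x]>)%VS.
  by apply/negP => /dimvS; rewrite dA dim_vline; case: (x != 0).
pose w := lie_bracket x y.
have wA : w \in A by apply: (forall_inP (clA x xA)).
(* The plane is not abelian: only multiples of [x] commute with [x]. *)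
have w0 : w != 0.
  apply: contra yx => /eqP; apply: sl2_bracket_eq0 => //; exact: (subvP sA).
have defA : A = (<[x]> + <[y]>)%VS.
  apply/esym/eqP; rewrite eqEdim dA subv_add -!memvE xA yA /=.
  have sx : (<[x]> <= <[x]> + <[y]>)%VS by exact: addvSl.
  have := ltn_leqif (dimv_leqif_sup sx).
  rewrite dim_vline x0 subv_add subvv -memvE /= yx => ->//.
(* The bracket is orthogonal to both of its arguments, hence to the plane they span. As [w] itself
   lies in that plane, [w] is isotropic, hence proportional to some [nilp_mx p]. *)
have orth v : v \in A -> \tr (v *m w) = 0.
  rewrite defA => /memv_addP[_ /vlineP[k ->] [_ /vlineP[l ->] ->]].
  rewrite mulmxDl linearD /= -!scalemxAl !linearZ /= !(mxtrace_mulC _ w).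
  by rewrite tr_bracket_l tr_bracket_r !mulr0 addr0.
have ww := orth w wA.
have /sl2_mxP[[[a b] c] /= wE] := subvP sA w wA.
have [p [k [k0 wp]]] : exists p k, k != 0 /\ w = k *: nilp_mx p.
  rewrite wE; apply: isotropic_nilp; first by rewrite -wE.
  apply/(mulfI two_neq0); rewrite mulr0 -ww wE tr_mul_sl2_mx; ring.
exists p; apply/eqP; rewrite eqEdim dA dim_borel leqnn andbT.
apply/subvP => v vA; rewrite mem_borel (subvP sA) //=.
by have /eqP := orth v vA; rewrite wp -scalemxAr linearZ mulf_eq0 (negPf k0).
Qed.

End Sl2Structure.

(** * Number of Borel subalgebras through each type of line *)

Lemma det_mx22 (R : comPzRingType) (M : 'M[R]_2) :
  \det M = M 0 0 * M 1 1 - M 0 1 * M 1 0.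
Proof.
rewrite (expand_det_row _ 0) !big_ord_recl big_ord0 /cofactor !det_mx11 !mxE /=.
have e1 : lift 0 0 = 1 :> 'I_2 by apply: val_inj.
have e2 : lift 1 0 = 0 :> 'I_2 by apply: val_inj.
by rewrite !e1 !e2 /= expr0 expr1; ring.
Qed.

Lemma det_sl2_mx (R : comPzRingType) (a b c : R) :
  \det (sl2_mx a b c) = - (a ^+ 2 + b * c).
Proof. by rewrite det_mx22 !mxE /=; ring. Qed.

Lemma char_poly_sl2_mx (R : comNzRingType) (a b c s : R) :
  (char_poly (sl2_mx a b c)).[s] = s ^+ 2 - (a ^+ 2 + b * c).
Proof.
rewrite /char_poly det_mx22 !mxE /= !hornerE; ring.
Qed.

Section BorelCount.
Variable F : finFieldType.
Hypothesis two_neq0 : (2%:R : F) != 0.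
Local Notation sl2 := (sl F 2).
Implicit Types (a b c t : F) (u x y : 'M[F]_2) (A X : {vspace 'M[F]_2}).
Implicit Types (p : option F).

Definition borels A : {set option F} := [set p | (A <= borel p)%VS].

Lemma borels_borel p : borels (borel p) = [set p].
Proof. by apply/setP => p'; rewrite !inE borel_subset_eq // eq_sym. Qed.

Lemma card_borels_isotropic a b c : sl2_mx a b c != 0 -> a ^+ 2 + b * c = 0 ->
  #|borels <[sl2_mx a b c]>| = 1%N.
Proof.
move=> u0 /(isotropic_nilp u0)[p [k [k0 ->]]].
transitivity #|[set p]|; last exact: cards1.
apply: eq_card => p'; rewrite !inE -memvE rpredZeq (negPf k0).
by rewrite nilp_borel eq_sym.
Qed.

(** The two roots are (a + s) / c and (a - s) / c, distinct since 2 s is nonzero; if c = 0, one root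
    is infinity and the other solves a linear equation. *)
Lemma card_borels_split a b c s : s != 0 -> a ^+ 2 + b * c = s ^+ 2 ->
  #|borels <[sl2_mx a b c]>| = 2.
Proof.
move=> s0 E; have [c0|c0] := eqVneq c 0.
  have a0 : a != 0.
    by move: s0; rewrite -!(sqrf_eq0 s) -E c0 mulr0 addr0 sqrf_eq0.
  transitivity #|[set None; Some (- b / (2%:R * a))]|; last by rewrite cards2.
  apply: eq_card => -[t|]; rewrite !inE -memvE mem_borel_mx /= c0 ?eqxx //.
  rewrite mul0r subr0 addr_eq0 (inj_eq Some_inj).
  have a2 : 2%:R * a != 0 by rewrite mulf_neq0.
  by rewrite -[RHS](inj_eq (mulfI a2)) [_ * (_ / _)]mulrC divfK.
transitivity #|[set Some ((a + s) / c); Some ((a - s) / c)]|; last first.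
  rewrite cards2 (inj_eq Some_inj) (inj_eq (divIf c0)) (inj_eq (addrI a)).
  by rewrite -addr_eq0 (_ : s + s = 2%:R * s) ?mulf_eq0;
    [rewrite (negPf two_neq0) (negPf s0) | ring].
apply: eq_card => -[t|]; rewrite !inE -memvE mem_borel_mx /=; last by rewrite (negPf c0).
have root_eq r : (t == r / c) = (c * t - r == 0).
  by rewrite subr_eq0 -[LHS](inj_eq (mulfI c0)) [c * (r / c)]mulrC divfK.
(* Multiplying the form by the nonzero c completes the square: it becomes s^2 - (c t - a)^2. *)
rewrite !(inj_eq Some_inj) !root_eq -mulf_eq0 -[LHS]orFb -(negPf c0) -mulf_eq0.
rewrite -[RHS]oppr_eq0; congr (_ == 0).
transitivity (a ^+ 2 + b * c - (c * t - a) ^+ 2); first by ring.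
by rewrite E; ring.
Qed.

(** A finite root t would make a^2 + b c the square of c t - a, and a root at infinity, where c = 0,
    would make it the square of a. *)
Lemma card_borels_nonsplit a b c : (forall s, s ^+ 2 != a ^+ 2 + b * c) ->
  #|borels <[sl2_mx a b c]>| = 0%N.
Proof.
move=> E; apply/eqP; rewrite cards_eq0; apply/eqP/setP => -[t|].
all: rewrite !inE -memvE mem_borel_mx /=; apply/negP => /eqP H.
  have /eqP[] := E (c * t - a); rewrite -[LHS]addr0 -(mulr0 c) -H; ring.
by have /eqP[] := E a; rewrite H mulr0 addr0.
Qed.

Lemma sl2_lineP A : sl2_line A ->
  exists a b c, A = <[sl2_mx a b c]>%VS /\ sl2_mx a b c != 0.
Proof.
case=> /andP[sA _] dA; have A0 : A != 0%VS by rewrite -dimv_eq0 dA.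
have [[[a b] c] /= E] := sl2_mxP (subvP sA _ (memv_pick A)).
exists a, b, c; rewrite -E vpick0; split=> //.
apply/esym/eqP; rewrite eqEdim -memvE memv_pick dA dim_vline.
by rewrite vpick0 A0.
Qed.

Lemma card_borels_line_lt3 A : sl2_line A -> (#|borels A| < 3)%N.
Proof.
move=> /sl2_lineP[a [b [c [-> u0]]]].
have [[s /eqP E]|] := altP (@existsP F (fun s => s ^+ 2 == a ^+ 2 + b * c)).
  have [s0|s0] := eqVneq s 0; last by rewrite (card_borels_split s0).
  by rewrite card_borels_isotropic // -E s0 expr0n.
by rewrite negb_exists => /forallP/card_borels_nonsplit ->.
Qed.

Lemma card_borels_line1 A : sl2_line A -> #|borels A| = 1%N ->
  exists p, A = <[nilp_mx p]>%VS.
Proof.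
move=> /sl2_lineP[a [b [c [-> u0]]]] k1.
have [[s /eqP E]|] := altP (@existsP F (fun s => s ^+ 2 == a ^+ 2 + b * c)); last first.
  by rewrite negb_exists => /forallP/card_borels_nonsplit; rewrite k1.
have [s0|s0] := eqVneq s 0; last by rewrite (card_borels_split s0) in k1.
have [|p [k [k0 ->]]] := isotropic_nilp u0; first by rewrite -E s0 expr0n.
exists p; apply/eqP; rewrite eqEdim -memvE memvZ ?memv_line //.
by rewrite !dim_vline scaler_eq0 (negPf k0) nilp_neq0.
Qed.

Lemma card_borels_nilp p : #|borels <[nilp_mx p]>| = 1%N.
Proof.
transitivity #|[set p]|; last exact: cards1.
by apply: eq_card => p'; rewrite !inE -memvE nilp_borel eq_sym.
Qed.

Lemma line_generator A u : sl2_line A -> A = <[u]>%VS ->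
  exists a b c, u = sl2_mx a b c.
Proof.
case=> /andP[sA _] _ defA; have [|[[a b] c] E] := @sl2_mxP F u.
  by rewrite (subvP sA) // defA memv_line.
by exists a, b, c.
Qed.

(** A nilpotent matrix has determinant 0, and a^2 + b c is minus the determinant. *)
Lemma card_borels_nilpotent A : nilpotent_line A -> #|borels A| = 1%N.
Proof.
case=> lA [u [u0 defA [k uk]]]; have [a [b [c uE]]] := line_generator lA defA.
rewrite defA uE card_borels_isotropic -?uE //; apply: oppr_inj.
rewrite -det_sl2_mx -uE oppr0.
have detX i : \det (u ^+ i) = \det u ^+ i.
  by elim: i => [|i IHi]; rewrite ?det1 // !exprS detM IHi.
have /eqP := detX k; rewrite uk det0 // eq_sym expf_eq0 => /andP[_ /eqP //].
Qed.

(** Trace 0 makes the eigenvalues d and - d, so a^2 + b c = - det u = d^2; d is nonzero because u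
    is. *)
Lemma card_borels_split_ss A : split_ss_line A -> #|borels A| = 2.
Proof.
case=> lA [u [u0 defA [P uP]]]; have [a [b [c uE]]] := line_generator lA defA.
case/(diagonalizable_forLR uP) => D uD; rewrite mxpoly.conjVmx // in uD.
have trD : D 0 0 + D 0 1 = 0.
  have : \tr u = 0 by apply/eqP; rewrite -mem_sl uE mem_sl2_mx.
  rewrite uD mxtrace_mulC mulmxA mulmxV // mul1mx.
  rewrite /mxtrace !big_ord_recl big_ord0 !mxE /= addr0 => <-.
  by congr (_ + D _ _); apply: val_inj.
have detD : \det u = D 0 0 * D 0 1.
  rewrite uD !det_mulmx mulrC mulrA -det_mulmx mulmxV // det1 mul1r det_mx22.
  by rewrite !mxE /= mulr0 subr0.
move/eqP: trD; rewrite addrC addr_eq0 => /eqP D1.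
rewrite defA uE (card_borels_split (s := D 0 0)) //.
  apply: contra u0 => /eqP D0; rewrite uD (_ : diag_mx D = 0) ?mulmx0 ?mul0mx //.
  apply/matrixP => i j; rewrite !mxE; case: i => [[|[|//]] i2].
    by rewrite (_ : Ordinal i2 = 0) ?D0 ?mul0rn //; apply: val_inj.
  by rewrite (_ : Ordinal i2 = 1) ?D1 ?D0 ?oppr0 ?mul0rn //; apply: val_inj.
by apply: oppr_inj; rewrite -det_sl2_mx -uE detD D1 mulrN.
Qed.

Lemma card_borels_nonsplit_ss A : nonsplit_ss_line A -> #|borels A| = 0%N.
Proof.
case=> lA [u [u0 defA noroot]]; have [a [b [c uE]]] := line_generator lA defA.
rewrite defA uE card_borels_nonsplit // => s; have := noroot s.
by rewrite uE /root char_poly_sl2_mx subr_eq0.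
Qed.

End BorelCount.

(* Vertices, adjacency and degrees of the comaximal graph *)
Local Close Scope ring_scope.

Section ComaximalCounts.
Variable F : finFieldType.
Hypothesis two_neq0 : (2%:R : F)%R != 0%R.
Local Notation sl2 := (sl F 2).
Local Notation q := #|F|.
Local Notation V := (comax_vertices sl2).
Local Notation Gamma := (comaximal_graph sl2).
Implicit Types (A X : {vspace 'M[F]_2}) (p : option F).

Definition sl2_lines : {set {vspace 'M[F]_2}} :=
  [set A | (A <= sl2)%VS && (\dim A == 1)].

Lemma sl2_lines_line A : A \in sl2_lines -> sl2_line A.
Proof.
rewrite inE => /andP[sA /eqP dA]; split=> //; rewrite /lie_subalg sA /=.
have A0 : A != 0%VS by rewrite -dimv_eq0 dA.
have -> : A = <[vpick A]>%VS.
  by apply/esym/eqP; rewrite eqEdim -memvE memv_pick dA dim_vline vpick0 A0.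
apply/forall_inP => x /vlineP[k ->]; apply/forall_inP => y /vlineP[l ->].
rewrite /lie_bracket -!scalemxAl -!scalemxAr !scalerA (mulrC l k) subrr.
exact: mem0v.
Qed.

(** The ambient dimension is 3, so a vertex has dimension 1 or 2. Every line is a subalgebra, and
    the planes that are subalgebras are the [borel p]. *)
Lemma comax_verticesE : V = sl2_lines :|: [set borel p | p : option F].
Proof.
apply/setP => A; rewrite !inE; apply/and3P/orP => [[sA A0 AL]|].
  have sAL : (A <= sl2)%VS by case/andP: sA.
  have := ltn_leqif (dimv_leqif_eq sAL); rewrite AL dim_sl2 //.
  rewrite -dimv_eq0 in A0; rewrite sAL /=.
  case E: (\dim A) A0 => [|[|[|]]] // _ _; first by left.
  right; have [p ->] := plane_subalg_borel two_neq0 (conj sA E).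
  exact: imset_f.
case=> [lA|/imsetP[p _ ->]].
  have [sA dA] : sl2_line A by apply: sl2_lines_line; rewrite inE.
  rewrite sA -dimv_eq0 dA; split=> //.
  by apply/eqP => AL; move: dA; rewrite AL dim_sl2.
rewrite borel_lie_subalg -dimv_eq0 dim_borel //; split=> //.
apply/eqP => E; have := dim_borel two_neq0 p.
by rewrite E dim_sl2.
Qed.

Lemma borel_vertex p : borel p \in V.
Proof. by rewrite comax_verticesE inE imset_f ?orbT. Qed.

Lemma line_vertex A : sl2_line A -> A \in V.
Proof. by case=> /andP[sA _] dA; rewrite comax_verticesE !inE sA dA. Qed.

Lemma q_gt1 : 1 < q.
Proof. exact: finNzRing_gt1. Qed.

Lemma card_plane_lines p :
  #|[set A : {vspace 'M[F]_2} | (A <= borel p)%VS && (\dim A == 1)]| = q + 1.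
Proof.
have := card_lines (borel p); rewrite dim_borel // => E.
have q1 : 0 < q - 1 by rewrite subn_gt0 q_gt1.
by apply/eqP; rewrite -(eqn_pmul2r q1) E mulnC -(subn_sqr q 1).
Qed.

Lemma card_sl2_lines : #|sl2_lines| = q ^ 2 + q + 1.
Proof.
have := card_lines sl2; rewrite dim_sl2 // -/sl2_lines => E.
have q1 : 0 < q - 1 by rewrite subn_gt0 q_gt1.
apply/eqP; rewrite -(eqn_pmul2r q1) E mulnBr muln1; apply/eqP; rewrite !mulnDl -expnSr.
by lia.
Qed.

Lemma borel_notin_lines p : borel p \notin sl2_lines.
Proof. by rewrite inE dim_borel // andbF. Qed.

Lemma card_borel_image (P : {pred option F}) : #|[set borel p | p in P]| = #|P|.
Proof. by rewrite card_imset //; exact: borel_inj. Qed.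

Lemma cardsU_lines_borels (S : {set {vspace 'M[F]_2}}) : S \subset sl2_lines ->
  #|S :|: [set borel p | p : option F]| = #|S| + (q + 1).
Proof.
move=> sS; rewrite cardsU card_borel_image card_option addn1.
suff -> : S :&: [set borel p | p : option F] = set0 by rewrite cards0 subn0.
apply/setP => A; rewrite !inE; apply/negP => /andP[/(subsetP sS)].
by move=> + /imsetP[p _ AE]; rewrite AE (negPf (borel_notin_lines p)).
Qed.

Lemma card_vertices : #|V| = q ^ 2 + 2 * q + 2.
Proof.
rewrite comax_verticesE cardsU_lines_borels // card_sl2_lines; ring.
Qed.

Lemma card_vertices_below p : #|[set X in V | (X <= borel p)%VS]| = q + 2.
Proof.
pose S := [set A : {vspace 'M[F]_2} | (A <= borel p)%VS && (\dim A == 1)].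
have -> : [set X in V | (X <= borel p)%VS] = borel p |: S.
  apply/setP => X; rewrite comax_verticesE !inE.
  apply/idP/idP => [/andP[]|].
    case/orP => [/andP[_ dX] sX|/imsetP[p' _ ->]]; first by rewrite sX dX orbT.
    by rewrite borel_subset_eq // => /eqP->; rewrite eqxx.
  case/orP => [/eqP->|/andP[sX ->]].
    by rewrite subvv andbT imset_f ?orbT.
  by rewrite sX (subv_trans sX) ?borel_sub_sl2.
rewrite cardsU1 card_plane_lines inE dim_borel // andbF /=; ring.
Qed.

Lemma dim_sum_ge2 A X : A \in V -> X \in V -> A != X -> 1 < \dim (A + X).
Proof.
rewrite !inE => /and3P[_ A0 _] /and3P[_ X0 _] AX; rewrite -dimv_eq0 in A0.
rewrite -dimv_eq0 in X0.
have [AE|AN] := eqVneq A (A + X)%VS.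
  have sXA : (X <= A)%VS by rewrite AE addvSr.
  have := ltn_leqif (dimv_leqif_eq sXA); rewrite eq_sym AX -AE.
  by case: (\dim X) X0 => // n _; apply: leq_ltn_trans.
have := ltn_leqif (dimv_leqif_eq (addvSl A X)); rewrite AN.
by case: (\dim A) A0 => // n _; apply: leq_ltn_trans.
Qed.

(** The sum of two distinct vertices has dimension at least 2, so it fills any Borel subalgebra
    containing both. *)
Lemma common_borel_unique A X p p' : A \in V -> X \in V -> A != X ->
  (A <= borel p)%VS -> (X <= borel p)%VS ->
  (A <= borel p')%VS -> (X <= borel p')%VS -> p = p'.
Proof.
move=> AV XV AX Ap Xp Ap' Xp'; apply: borel_inj.
have eqB r : (A <= borel r)%VS -> (X <= borel r)%VS -> (A + X)%VS = borel r.
  by move=> Ar Xr; apply/eqP; rewrite eqEdim subv_add Ar Xr dim_borel // dim_sum_ge2.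
by rewrite -(eqB p Ap Xp) (eqB p' Ap' Xp').
Qed.

Lemma comax_adj_borel A X : A \in V -> X \in V -> A != X ->
  comax_adj sl2 A X = [disjoint borels A & borels X].
Proof.
move=> AV XV AX; rewrite /comax_adj AV XV AX /=; apply/eqP/idP => [gen|dis].
  rewrite -setI_eq0; apply/eqP/setP => p; rewrite !inE; apply/negP => /andP[Ap Xp].
  have sub : (lie_gen sl2 A X <= borel p)%VS.
    by apply: bigcapv_inf (subvv _); rewrite borel_lie_subalg // Ap Xp.
  by move: sub => /dimvS; rewrite gen dim_sl2 // dim_borel.
apply/eqP; rewrite eqEsubv; apply/andP; split.
  apply: bigcapv_inf (subvv _); rewrite sl_lie_subalg.
  by move: AV XV; rewrite !inE => /and3P[/andP[-> _] _ _] /and3P[/andP[-> _] _ _].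
(* A proper subalgebra containing both vertices has dimension at least 2, so it would be a common
   Borel subalgebra. *)
apply/subv_bigcapP => U /and3P[sU AU XU].
have sAX : (A + X <= U)%VS by rewrite subv_add AU.
have dU : 1 < \dim U := leq_trans (dim_sum_ge2 AV XV AX) (dimvS sAX).
have [->|UL] := eqVneq U sl2; first exact: subvv.
have UV : U \in V by rewrite inE sU UL -dimv_eq0 -lt0n (ltnW dU).
move: UV; rewrite comax_verticesE !inE => /orP[/andP[_ /eqP E]|/imsetP[p _ UE]].
  by rewrite E in dU.
have /pred0P/(_ p) := dis.
by rewrite /= !inE -UE AU XU.
Qed.

Lemma degree_card_borels A : A \in V ->
  degree Gamma A + #|borels A| * (q + 1) = (q + 1) ^ 2.
Proof.
move=> AV.
(* Each other vertex is either adjacent to [A] or shares exactly one Borel subalgebra with it;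
   summing this identity over [X] gives the lemma. *)
have one X : X \in V :\ A ->
    (comax_adj sl2 A X : nat) + #|borels A :&: borels X| = 1.
  rewrite in_setD1 eq_sym => /andP[AX XV]; rewrite comax_adj_borel //.
  rewrite -setI_eq0; have [->|[p]] := set_0Vmem (borels A :&: borels X).
    by rewrite eqxx cards0.
  move=> pAX; have -> : borels A :&: borels X = [set p].
    apply/setP => p'; rewrite !inE; move: pAX; rewrite !inE => /andP[Ap Xp].
    apply/andP/eqP => [[Ap' Xp']|->//].
    exact: (@common_borel_unique A X).
  by rewrite cards1 -cards_eq0 cards1.
have cardV : #|V :\ A| = (q + 1) ^ 2.
  have := cardsD1 A V; rewrite AV card_vertices add1n => H.
  by apply: succn_inj; rewrite -H; ring.
transitivity (\sum_(X in V :\ A) (comax_adj sl2 A X + #|borels A :&: borels X|));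
  last by rewrite -cardV -sum1_card; apply: eq_bigr.
rewrite big_split /=; congr addn.
  rewrite /degree -sum1_card big_mkcond [RHS]big_mkcond /=; apply: eq_bigr => X _.
  rewrite !inE; case adjAX: (comax_adj _ _ _); last by case: ifP.
  have /and4P[_ XV AX _] := adjAX; move: XV; rewrite eq_sym AX inE => -> //.
(* Double counting: each Borel subalgebra above [A] contains q + 2 vertices, hence q + 1 besides
   [A]. *)
transitivity (\sum_(p in borels A) #|[set X in V :\ A | (X <= borel p)%VS]|).
  rewrite -sum_nat_const; apply: eq_bigr => p; rewrite inE => Ap.
  have := card_vertices_below p.
  rewrite (cardsD1 A) inE AV Ap add1n => H; apply: succn_inj.
  rewrite -addn1 -addnA -[1 + 1]/2 -H; congr _.+1; apply: eq_card => X.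
  by rewrite !inE andbA.
under eq_bigr do rewrite -sum1_card.
under [RHS]eq_bigr do rewrite -sum1_card.
rewrite (exchange_big_dep (mem (V :\ A))) /=; last first.
  by move=> p X _; rewrite inE => /andP[].
apply: eq_bigr => X XV; apply: eq_bigl => p.
by rewrite in_setI [X \in [set _ in _ | _]]inE XV !inE.
Qed.

(** Incidences counted from the other side: q + 1 Borel subalgebras, each containing q + 2
    vertices. *)
Lemma sum_card_borels : \sum_(A in V) #|borels A| = (q + 1) * (q + 2).
Proof.
transitivity (\sum_(p : option F) (q + 2)).
  under [RHS]eq_bigr => p _ do rewrite -(card_vertices_below p) -sum1_card.
  under eq_bigr do rewrite -sum1_card.
  rewrite (exchange_big_dep predT) //=.
  by apply: eq_bigr => p _; apply: eq_bigl => A; rewrite !inE.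
by rewrite sum_nat_const card_option addn1.
Qed.

(** These vertices are the q + 1 nilpotent lines and the q + 1 Borel subalgebras themselves. *)
Lemma card_borels1_vertices : #|[set A in V | #|borels A| == 1]| = 2 * (q + 1).
Proof.
pose N := [set <[nilp_mx p]>%VS | p : option F].
have nL p : <[nilp_mx p]>%VS \in sl2_lines.
  by rewrite inE -memvE nilp_sl2 dim_vline nilp_neq0.
have -> : [set A in V | #|borels A| == 1] = N :|: [set borel p | p : option F].
  apply/setP => A; rewrite comax_verticesE in_set !in_setU.
  apply/andP/orP => [[/orP[lA|->] /eqP k1]|[|Ab]]; [left| by right | |].
  - have [p ->] := card_borels_line1 two_neq0 (sl2_lines_line lA) k1.
    exact: imset_f.
  - by case/imsetP => p _ ->; rewrite nL card_borels_nilp.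
  - by rewrite Ab orbT; case/imsetP: Ab => p _ ->; rewrite borels_borel // cards1.
rewrite cardsU_lines_borels; last by apply/subsetP => _ /imsetP[p _ ->].
rewrite card_imset ?card_option; first by ring.
move=> p p' E; apply/eqP; rewrite -nilp_borel // memvE E -memvE.
by rewrite nilp_borel.
Qed.

End ComaximalCounts.

(** * Degrees, multiplicities, order and size *)

Theorem corollary4p15 (F : finFieldType) (q : nat)
    (hq : #|F| = q) (q_odd : odd q) :
  let L := sl F 2 in
  let Gamma := comaximal_graph L in
  (forall B, sl2_borel B ->
     B \in vertices Gamma /\ degree Gamma B = q ^ 2 + q) /\
  ((forall A, sl2_line A ->
      [/\ A \in vertices Gamma,
          nilpotent_line A -> degree Gamma A = q ^ 2 + q,
          split_ss_line A -> degree Gamma A = q ^ 2 - 1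
        & nonsplit_ss_line A -> degree Gamma A = (q + 1) ^ 2]) /\
   (forall B A, sl2_borel B -> nilpotent_line A ->
      degree Gamma B = degree Gamma A /\ degree Gamma A = q ^ 2 + q)) /\
  (perm_eq (degree_seq Gamma)
     (nseq (2 * (q + 1)) (q ^ 2 + q)
        ++ nseq (q * (q + 1) %/ 2) (q ^ 2 - 1)
        ++ nseq (q * (q - 1) %/ 2) ((q + 1) ^ 2)) /\
   (3 <= q -> ~ regular Gamma)) /\
  (graph_order Gamma = (q + 1) ^ 2 + 1 /\
   graph_size Gamma = q * (q + 1) ^ 3 %/ 2).
Proof.
move=> L Gamma; have two_neq0 : (2%:R : F)%R != 0%R.
  by apply: odd_card_nat2_neq0; rewrite hq.
have q1 : 1 < q by rewrite -hq; exact: q_gt1.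
have degE A : A \in vertices Gamma ->
    degree Gamma A + #|borels A| * (q + 1) = (q + 1) ^ 2.
  by move=> AV; rewrite -hq degree_card_borels.
have deg_k A : A \in vertices Gamma -> degree Gamma A = (q + 1) * (q + 1 - #|borels A|).
  by move/degE => E; rewrite mulnBr; lia.
have g0 : (q + 1) * (q + 1 - 0) = (q + 1) ^ 2 by rewrite subn0.
have g1 : (q + 1) * (q + 1 - 1) = q ^ 2 + q by lia.
have g2 : (q + 1) * (q + 1 - 2) = q ^ 2 - 1 by nia.
have degB B : sl2_borel B -> B \in vertices Gamma /\ degree Gamma B = q ^ 2 + q.
  move=> /(plane_subalg_borel two_neq0)[p ->]; have BV := borel_vertex two_neq0 p.
  by rewrite deg_k // borels_borel // cards1 g1.
have degN A : nilpotent_line A -> degree Gamma A = q ^ 2 + q.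
  move=> nA; rewrite deg_k ?card_borels_nilpotent //.
  by apply: line_vertex => //; case: nA.
have cV : #|vertices Gamma| = (q + 1) ^ 2 + 1.
  by rewrite (card_vertices two_neq0) hq; lia.
have k3 : {in enum (vertices Gamma), forall A, #|borels A| < 3}.
  move=> A; rewrite mem_enum /= comax_verticesE // in_setU => /orP[lA|/imsetP[p _ ->]].
    exact/card_borels_line_lt3/sl2_lines_line.
  by rewrite borels_borel // cards1.
have countE i : count (fun A => #|borels A| == i) (enum (vertices Gamma))
    = #|[set A in vertices Gamma | #|borels A| == i]|.
  rewrite -size_filter cardE; apply: perm_size; apply: uniq_perm.
  - by rewrite filter_uniq ?enum_uniq.
  - exact: enum_uniq.
  - by move=> A; rewrite mem_filter !mem_enum [RHS]in_set andbC.
have n1 : count (fun A => #|borels A| == 1) (enum (vertices Gamma)) = 2 * (q + 1).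
  by rewrite countE /= card_borels1_vertices // hq.
have sum_borels : \sum_(A in vertices Gamma) #|borels A| = (q + 1) * (q + 2).
  by rewrite -hq; exact: sum_card_borels.
have [] := sum_count_fibers3 k3; rewrite -cardE cV n1 big_enum sum_borels.
move=> sum_k size_V.
set n2 := count (fun A => #|borels A| == 2) _ in sum_k size_V.
set n0 := count (fun A => #|borels A| == 0) _ in size_V.
(* The incidence count reads (q + 1) (q + 2) = 2 (q + 1) + 2 [n2]; proving the doubled equation
   shows that the division by 2 is exact. *)
have n2E : n2 = q * (q + 1) %/ 2.
  suff -> : q * (q + 1) = n2 * 2 by rewrite mulnK.
  by clear -sum_k; lia.
(* The vertex count leaves [n2] + [n0] = q^2. *)
have n0E : n0 = q * (q - 1) %/ 2.
  suff -> : q * (q - 1) = n0 * 2 by rewrite mulnK.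
  by rewrite mulnBr; clear -sum_k size_V q1; nia.
have seqE : degree_seq Gamma =
    [seq (q + 1) * (q + 1 - #|borels A|) | A <- enum (vertices Gamma)].
  by apply/eq_in_map => A; rewrite mem_enum; apply: deg_k.
have permE : perm_eq (degree_seq Gamma)
     (nseq (2 * (q + 1)) (q ^ 2 + q)
        ++ nseq (q * (q + 1) %/ 2) (q ^ 2 - 1)
        ++ nseq (q * (q - 1) %/ 2) ((q + 1) ^ 2)).
  rewrite seqE -n1 -n2E -n0E -g0 -g1 -g2.
  exact: (@perm_map_fibers3 _ _ (fun k => (q + 1) * (q + 1 - k))).
split=> //; split.
  split=> [A lA|B A /degB[_ ->] /degN ->//].
  have AV := line_vertex two_neq0 lA.
  split=> //; first exact: degN.
    by move=> /(card_borels_split_ss two_neq0) kA; rewrite deg_k // kA.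
  by move=> /card_borels_nonsplit_ss kA; rewrite deg_k // kA.
split.
  split=> // _ [k regk].
  have regs x : x \in degree_seq Gamma -> x = k.
    by case/mapP => A; rewrite mem_enum => /regk <-.
  have H1 : q ^ 2 + q = k.
    by apply: regs; rewrite (perm_mem permE) mem_cat mem_nseq eqxx addn1.
  have H2 : (q + 1) ^ 2 = k.
    (* The value (q + 1)^2 occurs in the sequence only if its multiplicity is positive. *)
    have pos : 0 < q * (q - 1) %/ 2 by rewrite divn_gt0 //; clear -q1; nia.
    apply: regs; rewrite (perm_mem permE) !mem_cat.
    by rewrite [X in _ || (_ || X)]mem_nseq eqxx pos !orbT.
  by clear -H1 H2 q1; lia.
split=> //.
(* By the handshake identity, twice the size is ((q + 1)^2 + 1) (q + 1)^2 - (q + 1)^2 (q + 2) = q (q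
   + 1)^3. *)
suff -> : q * (q + 1) ^ 3 = graph_size Gamma * 2 by rewrite mulnK.
rewrite [RHS]mulnC -handshake.
have : \sum_(A in vertices Gamma) (degree Gamma A + #|borels A| * (q + 1))
    = #|vertices Gamma| * (q + 1) ^ 2.
  by rewrite -sum_nat_const; apply: eq_bigr => A /degE.
rewrite big_split -big_distrl sum_borels cV /=.
by clear; lia.
Qed.
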